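(* There exist planar graphs that are not $(4,2)$-correspondence choosable.
   Context: Graphs are finite and simple. An $\ell$-list assignment $L$ for a graph $G$ is a function that assigns to each vertex $v\in V(G)$ a list (set) $L(v)$ of at least $\ell$ colours. A correspondence assignment $(L,M)$ for $G$ is a list assignment $L$ together with a function $M$ that assigns to every edge $e=uv\in E(G)$ a partial matching $M_e$ between $\{u\}\times L(u)$ and $\{v\}\times L(v)$. An $(L,M)$-colouring of $G$ is a function $\varphi$ that assigns to each vertex $v\in V(G)$ a colour $\varphi(v)\in L(v)$ such that for every $e=uv\in E(G)$ we have $(u,\varphi(u))(v,\varphi(v))\notin M_e$ (that is, $(u,\varphi(u))$ and $(v,\varphi(v))$ are not matched to each other by $M_e$). $G$ is $(L,M)$-colourable if such a colouring exists. For positive integers $\ell,k$, a correspondence assignment $(L,M)$ for $G$ is an $(\ell,k)$-correspondence assignment if $L$ is an $\ell$-list assignment and $|M_e|\leq k$ for every edge $e\in E(G)$. $G$ is $(\ell,k)$-correspondence choosable if $G$ is $(L,M)$-colourable for every $(\ell,k)$-correspondence assignment $(L,M)$ for $G$. *)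

(* Defs.v *)
From HB Require Import structures.
From mathcomp Require Import all_boot all_order all_algebra.
From mathcomp Require Import all_classical all_reals all_analysis.

Set Implicit Arguments.
Unset Strict Implicit.
Unset Printing Implicit Defensive.

Import Order.TTheory GRing.Theory Num.Theory.
Import numFieldNormedType.Exports.

Local Open Scope classical_set_scope.
Local Open Scope ring_scope.
Local Open Scope card_scope.

Record sgraph := SGraph {
  vertex :> finType;
  adj : rel vertex;
  adj_sym : symmetric adj;
  adj_irrefl : irreflexive adj }.

Section Planarity.
Variable R : realType.

Definition is_arc (p q : R * R) (A : set (R * R)) : Prop :=
  exists gamma : R -> R * R,
    [/\ {within `[0, 1], continuous gamma},
        {in `[0, 1] &, injective gamma},
        gamma 0 = p, gamma 1 = q & gamma @` `[0, 1] = A].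

(* [arc u v] is meaningful only when [u] and [v] are adjacent; [drawing_sym]
   makes it depend only on the unordered edge. *)
Record is_plane_drawing (G : sgraph) (pos : G -> R * R)
    (arc : G -> G -> set (R * R)) : Prop := {
  drawing_inj : injective pos;
  drawing_arc : forall u v, adj u v -> is_arc (pos u) (pos v) (arc u v);
  drawing_sym : forall u v, adj u v -> arc u v = arc v u;
  drawing_vertex : forall u v w, adj u v ->
    ~ (arc u v `\` [set pos u; pos v]) (pos w);
  drawing_edge : forall u v x y, adj u v -> adj x y ->
    [set u; v]%SET != [set x; y]%SET ->
    (arc u v `\` [set pos u; pos v]) `&` arc x y = set0 }.

Definition planar (G : sgraph) : Prop :=
  exists (pos : G -> R * R) (arc : G -> G -> set (R * R)),
    is_plane_drawing pos arc.

End Planarity.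

Section Correspondence.
Variables (G : sgraph) (C : Type).

Definition partial_matching (A B : set C) (N : set (C * C)) : Prop :=
  N `<=` A `*` B /\
  forall p q, N p -> N q -> p.1 = q.1 \/ p.2 = q.2 -> p = q.

Definition list_assignment (l : nat) (L : G -> set C) : Prop :=
  forall v, `I_l #<= L v.

(* For an edge [uv], the pair [(a, b)] lies in [M u v] when [(u, a)] and
   [(v, b)] are matched by [M_uv]; [M u v] and [M v u] are converse relations
   describing the same matching. *)
Definition correspondence_assignment (L : G -> set C)
    (M : G -> G -> set (C * C)) : Prop :=
  forall u v, adj u v ->
    partial_matching (L u) (L v) (M u v) /\
    forall a b, M u v (a, b) <-> M v u (b, a).

Definition lk_correspondence_assignment (l k : nat) (L : G -> set C)
    (M : G -> G -> set (C * C)) : Prop :=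
  [/\ list_assignment l L, correspondence_assignment L M
    & forall u v, adj u v -> M u v #<= `I_k].

Definition is_colouring (L : G -> set C) (M : G -> G -> set (C * C))
    (phi : G -> C) : Prop :=
  (forall v, L v (phi v)) /\
  forall u v, adj u v -> ~ M u v (phi u, phi v).

Definition colourable (L : G -> set C) (M : G -> G -> set (C * C)) : Prop :=
  exists phi, is_colouring L M phi.

End Correspondence.

Definition correspondence_choosable (l k : nat) (G : sgraph) : Prop :=
  forall (C : Type) (L : G -> set C) (M : G -> G -> set (C * C)),
    lk_correspondence_assignment l k L M -> colourable L M.

(* Main.v *)
(* Fix the colours of two poles u and v, and let w, w' be adjacent common
   neighbours. Each pole removes one colour from w and from w', and a matching
   of size 2 between the colours that remain leaves just two choices for
   (w, w'). One of them is excluded in the triangle u w w', the other one in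
   v w w': inside a triangle with three fixed colours place an inner triangle,
   each of its vertices being adjacent to two of the corners. Each inner vertex
   keeps only two colours, and matching these identically along the inner
   triangle asks for a 2-colouring of K_3. As a matching has two edges, such a
   gadget excludes two pairs of colours of (u, v) at once, so that 8 gadgets in
   parallel between u and v exclude all 16 pairs. *)

Require Import Defs.
From mathcomp Require Import all_boot all_order all_algebra.
From mathcomp Require Import all_classical all_reals all_analysis.
From HB Require Import structures.
From Stdlib Require Import BinInt.
From mathcomp Require Import ring lra ssrZ.

Set Implicit Arguments.
Unset Strict Implicit.
Unset Printing Implicit Defensive.

Import Order.TTheory GRing.Theory Num.Theory.
Import numFieldNormedType.Exports.

Local Open Scope classical_set_scope.
Local Open Scope ring_scope.

(** * Segments that meet only in endpoints *)

Section Orientation.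
Variable D : realDomainType.
Implicit Types p q x y : D * D.

Definition orient p q x : D :=
  (q.1 - p.1) * (x.2 - p.2) - (q.2 - p.2) * (x.1 - p.1).

(* Either [x] and [y] lie strictly on the same side of the line [pq], or
   exactly one of them is on that line, and it is [p] or [q]. *)
Definition one_sided p q x y : bool :=
  let a := orient p q x in let b := orient p q y in
  [|| 0 < a * b, ((x == p) || (x == q)) && (b != 0)
    | ((y == p) || (y == q)) && (a != 0)].

Definition separated p q x y := one_sided p q x y || one_sided x y p q.

End Orientation.

Section Segments.
Variable R : realType.
Implicit Types p q x y z : R * R.

Definition segment_point p q (t : R) : R * R :=
  ((1 - t) * p.1 + t * q.1, (1 - t) * p.2 + t * q.2).

Definition segment p q : set (R * R) := segment_point p q @` `[0, 1].

Lemma segment_pointC p q t : segment_point p q t = segment_point q p (1 - t).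
Proof. by rewrite /segment_point; congr (_, _); ring. Qed.

Lemma segmentC p q : segment p q = segment q p.
Proof.
suff sub x y : segment x y `<=` segment y x by rewrite eqEsubset; split.
move=> _ [t /= /itvP t01 <-]; exists (1 - t); last by rewrite -segment_pointC.
by rewrite /= in_itv /= subr_ge0 t01 lerBlDr lerDl t01.
Qed.

Lemma segment_start p q : segment p q p.
Proof.
exists 0; first by rewrite /= in_itv /= lexx ler01.
by case: p => a b; rewrite /segment_point; congr (_, _); rewrite /=; ring.
Qed.

Lemma segment_is_arc p q : p != q -> is_arc p q (segment p q).
Proof.
move=> pq; exists (segment_point p q); split=> //.
- have coord (a b : R) : continuous (fun t : R => (1 - t) * a + t * b).
    move=> t; apply: cvgD; apply: cvgMr_tmp; last by [].
    by apply: cvgB; [exact: cvg_cst|].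
  apply: continuous_subspaceT => t.
  exact: (cvg_pair (coord p.1 q.1 t) (coord p.2 q.2 t)).
- move=> s t _ _ [e1 e2]; apply/eqP; apply: contraNT pq => st.
  have st0 : s - t != 0 by rewrite subr_eq0.
  rewrite [p]surjective_pairing [q]surjective_pairing.
  apply/eqP; congr (_, _); apply: (mulfI st0); lra.
- by case: p {pq} => a b; rewrite /segment_point; congr (_, _) => /=; ring.
- by case: q {pq} => a b; rewrite /segment_point; congr (_, _) => /=; ring.
Qed.

Lemma orient_segment_point p q x y t : orient p q (segment_point x y t) =
  (1 - t) * orient p q x + t * orient p q y.
Proof. by rewrite /orient /=; ring. Qed.

Lemma orient_start p q : orient p q p = 0.
Proof. by rewrite /orient; ring. Qed.

Lemma orient_end p q : orient p q q = 0.
Proof. by rewrite /orient; ring. Qed.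

(** The function [orient p q] is affine along [xy] and vanishes at [z]. If its values at [x] and [y]
    have the same sign, it has no zero in between; if just one of them is zero, [z] is that end. *)
Lemma one_sided_segments p q x y z : one_sided p q x y ->
  segment p q z -> segment x y z -> (z = p \/ z = q) /\ (z = x \/ z = y).
Proof.
move=> H [s _ <-] [t /= /itvP t01 E].
have [t0 t1] : 0 <= t /\ t <= 1 by rewrite !t01.
have := congr1 (orient p q) E.
rewrite !orient_segment_point orient_start orient_end !mulr0 addr0.
have endpoint w : (w == p) || (w == q) -> orient p q w = 0 /\ (w = p \/ w = q).
  by case/orP => /eqP ->; rewrite ?orient_start ?orient_end; auto.
rewrite -E; case/or3P: H.
- set a := orient p q x; set b := orient p q y => ab E0; exfalso.
  (* Multiplying by [a] makes both summands nonnegative, whatever the common sign. *)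
  have ha : (1 - t) * (a * a) + t * (a * b) = 0.
    by rewrite mulrCA (mulrCA t) -mulrDr E0 mulr0.
  have ha1 : 0 <= (1 - t) * (a * a).
    by rewrite mulr_ge0 ?subr_ge0// -expr2 sqr_ge0.
  have hb1 : 0 <= t * (a * b) by rewrite mulr_ge0// ltW.
  have : t * (a * b) = 0 by lra.
  move/eqP; rewrite mulf_eq0 (gt_eqF ab) orbF => /eqP tz.
  move: ha; rewrite tz mul0r addr0 subr0 mul1r => /eqP.
  by rewrite mulf_eq0 orbb => /eqP az; rewrite az mul0r ltxx in ab.
- case/andP=> /endpoint[-> xpq] b0; rewrite mulr0 add0r => /eqP.
  rewrite mulf_eq0 (negPf b0) orbF => /eqP ->.
  suff -> : segment_point x y 0 = x by auto.
  by rewrite /segment_point subr0 !mul0r !mul1r !addr0 -surjective_pairing.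
- case/andP=> /endpoint[-> ypq] a0; rewrite mulr0 addr0 => /eqP.
  rewrite mulf_eq0 (negPf a0) orbF subr_eq0 => /eqP <-.
  suff -> : segment_point x y 1 = y by auto.
  by rewrite /segment_point subrr !mul0r !mul1r !add0r -surjective_pairing.
Qed.

Lemma separated_segments p q x y z : separated p q x y ->
  segment p q z -> segment x y z -> z = p \/ z = q.
Proof.
by case/orP => H pz xz; [case: (one_sided_segments H pz xz)
                        |case: (one_sided_segments H xz pz)].
Qed.

End Segments.

(** * Passage from integer to real coordinates *)

Section LatticePoints.
Variable R : realType.
Implicit Types p q x y : Z * Z.

(** Binary integers let [vm_compute] decide the relative position of all edges. *)
Definition Zpoint p : R * R :=
  ((int_of_Z p.1)%:~R, (int_of_Z p.2)%:~R).

Lemma Zpoint_inj : injective Zpoint.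
Proof.
move=> [a b] [c d] [/intr_inj /(can_inj int_of_ZK) -> ].
by move=> /intr_inj /(can_inj int_of_ZK) ->.
Qed.

Lemma orient_Zpoint p q x : orient (Zpoint p) (Zpoint q) (Zpoint x) =
  (int_of_Z (orient p q x))%:~R.
Proof. by rewrite /orient !(rmorphB, rmorphM). Qed.

Lemma int_of_Z_gt0 (n : Z) : 0 < n -> 0 < int_of_Z n.
Proof.
case: n => //= n _; rewrite ltz_nat; apply/ssrnat.ltP; exact: Pos2Nat.is_pos.
Qed.

Lemma one_sided_Zpoint p q x y : one_sided p q x y ->
  one_sided (Zpoint p) (Zpoint q) (Zpoint x) (Zpoint y).
Proof.
rewrite /one_sided !orient_Zpoint !(inj_eq Zpoint_inj) -!rmorphM /= !intr_eq0.
have eq0 (n : Z) : (int_of_Z n == 0) = (n == 0) by rewrite -(can_eq int_of_ZK).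
rewrite !eq0.
by case/or3P=> [/int_of_Z_gt0 ab|->|->]; rewrite ?orbT // ltr0z ab.
Qed.

Lemma separated_Zpoint p q x y : separated p q x y ->
  separated (Zpoint p) (Zpoint q) (Zpoint x) (Zpoint y).
Proof. by case/orP => /one_sided_Zpoint H; rewrite /separated H ?orbT. Qed.

End LatticePoints.

(** * The graph built from eight gadgets *)

Definition bools := [:: false; true].

Definition index := (bool * bool * bool)%type.

Definition indices : seq index :=
  [seq (ab, c) | ab <- [seq (a, b) | a <- bools, b <- bools], c <- bools].

Lemma mem_bools b : b \in bools. Proof. by case: b. Qed.

Lemma mem_indices i : i \in indices. Proof. by case: i => [[[] []] []]. Qed.

(* The corners of the triangle on side [s] of gadget [i] are [Pole s] (written
   [None]) and [Rim i c] (written [Some c]); [Inner i s j] is the inner vertex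
   opposite to the corner [j]. *)
Inductive gvertex :=
  | Pole of bool
  | Rim of index & bool
  | Inner of index & bool & option bool.

Definition gvertex_code v : bool + index * bool + index * bool * option bool :=
  match v with
  | Pole s => inl (inl s)
  | Rim i c => inl (inr (i, c))
  | Inner i s j => inr (i, s, j)
  end.

Definition gvertex_decode c :=
  match c with
  | inl (inl s) => Pole s
  | inl (inr (i, c)) => Rim i c
  | inr (i, s, j) => Inner i s j
  end.

Lemma gvertex_codeK : cancel gvertex_code gvertex_decode.
Proof. by case. Qed.

HB.instance Definition _ := Finite.copy gvertex (can_type gvertex_codeK).

(** Each edge gets only one direction: an edge and its reverse would be unequal pairs of points that
    are not [separated]. *)
Definition arrow (u v : gvertex) : bool :=
  match u, v with
  | Pole _, Rim _ _ => true
  | Rim i c, Rim i' c' => (i == i') && (~~ c && c')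
  | Pole s, Inner _ s' j => (s == s') && (j != None)
  | Rim i c, Inner i' _ j => (i == i') && (j != Some c)
  | Inner i s j, Inner i' s' j' =>
      [&& i == i', s == s' &
        match j, j' with
        | None, Some _ => true
        | Some b, Some b' => ~~ b && b'
        | _, None => false
        end]
  | _, _ => false
  end.

Definition gadj : rel gvertex := fun u v => arrow u v || arrow v u.

Lemma gadj_sym : symmetric gadj.
Proof. by move=> u v; rewrite /gadj orbC. Qed.

Lemma gadj_irrefl : irreflexive gadj.
Proof.
by case=> [s|i c|i s j]; rewrite /gadj //= ?eqxx; [case: c|case: j => // -[]].
Qed.

Definition ggraph := SGraph gadj_sym gadj_irrefl.

Definition gvertices : seq gvertex :=
  [seq Pole s | s <- bools] ++
  flatten [seq [seq Rim i c | c <- bools] ++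
    [seq Inner i s j | s <- bools, j <- [:: None; Some false; Some true]]
    | i <- indices].

Lemma mem_gvertices v : v \in gvertices.
Proof.
rewrite mem_cat; case: v => [s|i c|i s j]; first by rewrite map_f ?mem_bools.
- apply/orP; right; apply/flatten_mapP; exists i; first exact: mem_indices.
  by rewrite mem_cat map_f ?mem_bools.
- apply/orP; right; apply/flatten_mapP; exists i; first exact: mem_indices.
  rewrite mem_cat; apply/orP; right; apply/allpairsP; exists (s, j).
  by rewrite mem_bools; case: j => // -[].
Qed.

Definition garrows : seq (gvertex * gvertex) :=
  [seq e <- [seq (u, v) | u <- gvertices, v <- gvertices] | arrow e.1 e.2].

Lemma mem_garrows u v : arrow u v -> (u, v) \in garrows.
Proof.
move=> uv; rewrite mem_filter uv; apply/allpairsP.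
by exists (u, v); rewrite !mem_gvertices.
Qed.

(** * The straight-line drawing *)

(* The chord of the parabola through the consecutive abscissas [k] and [k + 1]
   meets the axis at [- k * (k + 1) >= - 240], so the poles lie on opposite
   sides of all of them. *)
Definition corner_point (i : index) (s : bool) (j : option bool) : Z * Z :=
  match j with
  | None => (0, if s then -300 else 300)%Z
  | Some c =>
      let: (b2, b1, b0) := i in
      let k := (8 * Z.b2z b2 + 4 * Z.b2z b1 + 2 * Z.b2z b0 + Z.b2z c + 1)%Z in
      (k, k * k)%Z
  end.

(* Scaled by 5: the inner vertex opposite to a corner has barycentric
   coordinates 1/5 at that corner and 2/5 at the two others. *)
Definition gpoint (v : gvertex) : Z * Z :=
  match v with
  | Pole s => corner_point (false, false, false) s None *+ 5
  | Rim i c => corner_point i false (Some c) *+ 5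
  | Inner i s j =>
      (corner_point i s None + corner_point i s (Some false)
        + corner_point i s (Some true)) *+ 2 - corner_point i s j
  end.

Definition gsegments : seq ((Z * Z) * (Z * Z)) :=
  [seq (gpoint e.1, gpoint e.2) | e <- garrows].

Lemma gpoint_inj : injective gpoint.
Proof.
have H : all (fun u => all (fun v => (gpoint u == gpoint v) ==> (u == v))
  gvertices) gvertices by vm_compute.
move=> u v /eqP; move/allP: H => /(_ u (mem_gvertices u)).
by move=> /allP /(_ v (mem_gvertices v)) /implyP H /H /eqP.
Qed.

Lemma gsegments_separated : all (fun e => all (fun f =>
  (e == f) || separated e.1 e.2 f.1 f.2) gsegments) gsegments.
Proof. by vm_compute. Qed.

Lemma gpoint_separated u v x y : arrow u v -> arrow x y ->
  (u, v) != (x, y) -> separated (gpoint u) (gpoint v) (gpoint x) (gpoint y).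
Proof.
have mem a b : arrow a b -> (gpoint a, gpoint b) \in gsegments.
  by move=> ab; apply/mapP; exists (a, b); first exact: mem_garrows.
move=> /mem uv /mem xy; apply: contraNT => /negPf nsep.
have /allP/(_ _ uv)/allP/(_ _ xy) := gsegments_separated.
by rewrite /= nsep orbF => /eqP[/gpoint_inj -> /gpoint_inj ->].
Qed.

(** As no vertex is isolated, a vertex on a foreign edge would be a common point of two edges. This
    reduces [drawing_vertex] to the disjointness of edges. *)
Lemma gadj_other u v w : w != u -> w != v ->
  exists x, gadj w x /\ [set u; v]%SET != [set w; x]%SET.
Proof.
move=> wu wv; have [x wx] : exists x, gadj w x.
  case: w {wu wv} => [s|i c|i s [c|]].
  - by exists (Rim (false, false, false) false).
  - by exists (Pole false).
  - by exists (Pole s); rewrite /gadj /= eqxx.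
  - by exists (Rim i false); rewrite /gadj /= eqxx.
exists x; split=> //.
apply: contraNneq wu => E; have : w \in [set u; v]%SET by rewrite E !inE eqxx.
by rewrite !inE (negPf wv) orbF.
Qed.

Lemma ggraph_planar (R : realType) : planar R ggraph.
Proof.
pose pos (v : gvertex) := Zpoint R (gpoint v).
have pos_inj : injective pos by move=> u v /Zpoint_inj /gpoint_inj.
have disjoint u v x y z : gadj u v -> gadj x y ->
    [set u; v]%SET != [set x; y]%SET -> segment (pos u) (pos v) z ->
    segment (pos x) (pos y) z -> z = pos u \/ z = pos v.
  wlog uv : u v / arrow u v => [H adj_uv|_].
    case/orP: (adj_uv) => [/H|/H{}H]; first by apply.
    rewrite segmentC finset.setUC => *; apply/or_comm; apply: H => //.
    by rewrite gadj_sym.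
  wlog xy : x y / arrow x y => [H adj_xy|_].
    case/orP: (adj_xy) => [/H|/H{}H]; first by apply.
    rewrite (segmentC (pos x)) [X in _ != X]finset.setUC; apply: H.
    by rewrite gadj_sym.
  move=> uv_xy; apply: separated_segments; apply: separated_Zpoint.
  by apply: gpoint_separated => //; apply: contraNneq uv_xy => -[-> ->].
exists pos, (fun u v => segment (pos u) (pos v)); split=> //.
- move=> u v uv; apply: segment_is_arc; apply: contraTneq uv => /pos_inj ->.
  by rewrite /= gadj_irrefl.
- by move=> u v _; exact: segmentC.
- move=> u v w uv [uvw /not_orP[wu wv]].
  have /gadj_other H : w != u by apply/eqP => E; apply: wu; rewrite E.
  have /H[x [wx neq]] : w != v by apply/eqP => E; apply: wv; rewrite E.
  by case: (disjoint _ _ _ _ _ uv wx neq uvw (segment_start _ _)).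
- move=> u v x y uv xy neq; rewrite -subset0 => z [[uvz nz] xyz].
  exact/nz/(disjoint _ _ _ _ _ uv xy neq).
Qed.

(** * The correspondence assignment *)

(* The matching of the edge [uv] consists of the pairs
   [(key u v z, key v u z)]. Gadget [(d, p, q)] is responsible for the colours
   [(x, p)] and [(x (+) d, q)] of the two poles, where [x] is arbitrary: the
   poles then leave the colours [(false, _)] to the rim vertices, and the
   triangle on side [s] cannot be completed when [Rim i s] has colour
   [(false, x)] and [Rim i (~~ s)] has colour [(false, ~~ x)]. *)
Definition key (u v : gvertex) (z : bool) : bool * bool :=
  match u, v with
  | Pole s, Rim (d, p, q) _ | Pole s, Inner (d, p, q) _ _ =>
      (z (+) (s && d), if s then q else p)
  | Rim _ _, Pole s => (true, z (+) s)
  | Inner _ s j, Rim _ _ => (true, z (+) (j == Some (~~ s)))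
  | Inner _ _ _, Pole _ => (true, z)
  | _, _ => (false, z)
  end.

Lemma key_inj u v : injective (key u v).
Proof.
by move=> z z';
  case: u v => [s|i c|i s j] [s'|[[d p] q] c'|[[d p] q] s' j'] //=;
  case=> // /addIb.
Qed.

Definition matching (u v : ggraph) : set ((bool * bool) * (bool * bool)) :=
  range (fun z => (key u v z, key v u z)).

(** Each matching is parametrised by a Boolean, hence has at most two edges; [key_inj] makes it a
    matching. *)
Lemma matching_correspondence :
  lk_correspondence_assignment 4 2 (fun _ : ggraph => setT) matching.
Proof.
split=> [v|u v _|u v _].
- apply/pcard_injP; exists (fun n => (odd n, odd (half n))).
  by move=> m n; rewrite !inE; case: m n => [|[|[|[|?]]]] [|[|[|[|?]]]].
- split; last by move=> a b; split=> -[z _ [<- <-]]; exists z.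
  split=> [//|_ _ [z _ <-] [z' _ <-]] /=.
  by case=> /key_inj ->.
- have sub : matching u v `<=`
      (fun n => (key u v (odd n), key v u (odd n))) @` `I_2.
    by move=> _ [z _ <-]; exists z; [|rewrite oddb]; case: z.
  exact: card_le_trans (subset_card_le sub) (card_image_le _ _).
Qed.

Lemma matching_not_colourable :
  ~ colourable (fun _ : ggraph => setT) matching.
Proof.
case=> phi [_ proper].
have {}proper u v z : gadj u v -> phi u = key u v z -> phi v != key v u z.
  move=> uv u_z; apply/eqP => v_z; apply: (proper u v uv).
  by rewrite u_z v_z; exists z.
case ePu : (phi (Pole false)) => [x p]; case ePv : (phi (Pole true)) => [y q].
(* As [y = x (+) (x (+) y)], this is the gadget responsible for the colours of the poles. *)
set i : index := (x (+) y, p, q).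
have pole s : phi (Pole s) = (x (+) (s && (x (+) y)), if s then q else p).
  by case: s; rewrite ?ePu ?ePv /= ?addKb ?addbF.
(* Pole [s] forbids [(true, x (+) s)], so the two poles together forbid both colours [(true, _)]. *)
have rim c : phi (Rim i c) = (false, (phi (Rim i c)).2).
  have := proper (Pole false) (Rim i c) x isT (pole false).
  have := proper (Pole true) (Rim i c) x isT (pole true).
  by rewrite /= addbF addbT; case: (phi _) (x) => [[] []] [].
have rim_neq : (phi (Rim i true)).2 = ~~ (phi (Rim i false)).2.
  have := proper (Rim i false) (Rim i true) (phi (Rim i false)).2.
  rewrite /gadj /= eqxx => /(_ isT (rim false)); rewrite rim.
  by case: (_.2) (_.2) => [] [].
(* The second bits at the rim differ, so one rim vertex carries [x]; its index is the side whose
   triangle cannot be completed. *)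
have [s [rim_x rim_nx]] : exists s,
    phi (Rim i s) = (false, x) /\ phi (Rim i (~~ s)) = (false, ~~ x).
  exists ((phi (Rim i false)).2 (+) x).
  by case: (_.2) (x) (rim false) (rim true) rim_neq => [] [] -> -> /= ->.
have inner_pole c := proper (Pole s) (Inner i s (Some c)) x.
have inner_rim c j := proper (Rim i c) (Inner i s j).
have inner_none : (phi (Inner i s None)).1 = false.
  have := inner_rim s None x; have := inner_rim (~~ s) None (~~ x).
  rewrite /gadj /= eqxx => /(_ isT rim_nx) + /(_ isT rim_x).
  by rewrite !addbF; case: (phi _) (x) => [[] []] [].
(* The pole forbids [(true, x)]. The other corner has to forbid [(true, ~~ x)]: [Rim i (~~ s)] does
   so directly, [Rim i s] through the shift in [key] at [j = Some (~~ s)]. *)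
have inner_some c : (phi (Inner i s (Some c))).1 = false.
  have := inner_pole c; rewrite /gadj /= eqxx => /(_ isT (pole s)).
  have [->|/eqP ne] := eqVneq c s.
    have := inner_rim (~~ s) (Some s) (~~ x).
    rewrite /gadj /= eqxx => /(_ _ rim_nx).
    by case: (s); case: (phi _) (x) => [[] []] [] //= /(_ isT).
  have -> : c = ~~ s by case: (c) (s) ne => [] [].
  have := inner_rim s (Some (~~ s)) x.
  rewrite /gadj /= eqxx => /(_ _ rim_x).
  by case: (s); case: (phi _) (x) => [[] []] [] //= /(_ isT).
have inner_neq j j' : gadj (Inner i s j) (Inner i s j') ->
    (phi (Inner i s j)).1 = false -> (phi (Inner i s j')).1 = false ->
    (phi (Inner i s j)).2 != (phi (Inner i s j')).2.
  move=> /proper; case: (phi _) (phi _) => [a b] [a' b'] /= + aE a'E.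
  by rewrite aE a'E => /(_ _ erefl); apply: contraNneq => ->.
have := inner_neq None (Some false) _ inner_none (inner_some false).
have := inner_neq None (Some true) _ inner_none (inner_some true).
have := inner_neq _ (Some true) _ (inner_some false) (inner_some true).
rewrite /gadj /= !eqxx => /(_ isT) + /(_ isT) + /(_ isT).
by case: (_.2) (_.2) (_.2) => [] [] [].
Qed.

Theorem theorem1p8 (R : realType) :
  exists G : sgraph, planar R G /\ ~ correspondence_choosable 4 2 G.
Proof.
exists ggraph; split; first exact: ggraph_planar.
by move=> /(_ _ _ _ matching_correspondence); exact: matching_not_colourable.
Qed.
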